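(* Let $\delta,\delta^{\rm adv}\in(0,1)$ be small, $2\varepsilon\le\varepsilon^{\rm adv}\le\delta^{\rm adv}/2$, and $p\in(1/2,1)$. For the noisy binary search problem $\mathcal{P}=([0,1],\mathcal{F}^{\rm Abs},\phi^{{\sf sign},p})$, the secure query complexity satisfies $$T_{\mathcal{P}}(\varepsilon,\delta,\varepsilon^{\rm adv},\delta^{\rm adv})\ \ge\ \Omega\!\left(\frac{1-\delta}{\delta^{\rm adv}\,c(p)}\log\frac{\varepsilon^{\rm adv}}{\varepsilon}\right),\qquad c(p)=(2p-1)\log\frac{p}{1-p}>0.$$
   Context: $\mathcal{F}^{\rm Abs}=\{f(x)=|x-x^*|: x^*\in[0,1]\}$ on $[0,1]$. The noisy sign oracle $\phi^{{\sf sign},p}$ returns, at query $x$, the correct sign of the subgradient of $f$ at $x$ (whether $x$ is above or below $x^*$) with probability $p$ and the opposite sign with probability $1-p$, independently across queries. The learner sequentially queries $X_t$, observes $Y_t$, $t\le T$, outputs $\widehat X$; an adversary sees only the queries and outputs $\widehat X^{\rm adv}$. Error is $\mathrm{err}(x,f)=|x-x^*|$. $(\varepsilon,\delta)$-accurate: $\mathbb{P}(\mathrm{err}(\widehat X,f)\ge\varepsilon)\le\delta$ for all $f$. $(\varepsilon^{\rm adv},\delta^{\rm adv})$-private: for every reasonable adversary (strategy fixed in advance; uniform prior on the optimizer with consistent belief updates so expected posterior equals prior; ties broken uniformly) and every $f$, $\mathbb{P}(\mathrm{err}(\widehat X^{\rm adv},f)\le\varepsilon^{\rm adv})\le\delta^{\rm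 adv}$. The secure query complexity $T_{\mathcal{P}}$ is the least number of queries for which some algorithm is simultaneously $(\varepsilon,\delta)$-accurate and $(\varepsilon^{\rm adv},\delta^{\rm adv})$-private. *)

(* Defs.v *)
From HB Require Import structures.
From mathcomp Require Import all_boot all_order all_algebra.
From mathcomp Require Import all_classical all_reals all_analysis.
Set Implicit Arguments. Unset Strict Implicit. Unset Printing Implicit Defensive.
Import Order.TTheory GRing.Theory Num.Theory.
Local Open Scope ring_scope.
Local Open Scope classical_set_scope.

(* Problem P = ([0,1], F^Abs, phi^{sign,p});  f(x) = |x - xs|, xs in [0,1].  *)

(* Correct answer of the sign oracle at query x for optimizer xs:
   true  = "+" (x is at or above xs: subgradient sign +1),
   false = "-" (x is below xs).  At x = xs we use "+" by convention. *)
Definition sign_resp (R : realType) (xs x : R) : bool := xs <= x.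

Definition resp_prob (R : realType) (p xs x : R) (y : bool) : R :=
  if y == sign_resp xs x then p else 1 - p.

(* A learner making T queries with internal randomness w ~ P on Omega:
   q t w ys  = the (t+1)-th query given the t previous responses ys,
   out w ys  = the final output given all T responses.
   The probability of the response transcript ys (given w) is the product of
   the independent oracle answer probabilities. *)
Definition transcript_weight (R : realType) (Omega : Type)
  (q : nat -> Omega -> seq bool -> R) (T : nat) (p xs : R) (w : Omega)
  (ys : T.-tuple bool) : R :=
  \prod_(t < T) resp_prob p xs (q t w (take t ys)) (nth false ys t).

Definition queries (R : realType) (Omega : Type)
  (q : nat -> Omega -> seq bool -> R) (T : nat) (w : Omega) (ys : seq bool)
  : seq R :=
  [seq q t w (take t ys) | t <- iota 0 T].

Definition trans_expect (R : realType) (d : measure_display)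
  (Omega : measurableType d) (P : probability Omega R)
  (q : nat -> Omega -> seq bool -> R) (T : nat) (p xs : R)
  (g : Omega -> T.-tuple bool -> \bar R) : \bar R :=
  (\int[P]_(w in setT)
     (\sum_(ys : T.-tuple bool) ((@transcript_weight _ _ q T p xs w ys)%:E * g w ys)))%E.

Definition learner_measurable (R : realType) (d : measure_display)
  (Omega : measurableType d) (q : nat -> Omega -> seq bool -> R)
  (out : Omega -> seq bool -> R) : Prop :=
  (forall t ys, measurable_fun setT (fun w => q t w ys)) /\
  (forall ys, measurable_fun setT (fun w => out w ys)) /\
  (forall t w ys, 0 <= q t w ys <= 1).

Definition accurate (R : realType) (d : measure_display)
  (Omega : measurableType d) (P : probability Omega R)
  (q : nat -> Omega -> seq bool -> R) (out : Omega -> seq bool -> R)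
  (T : nat) (p eps delta : R) : Prop :=
  forall xs : R, 0 <= xs <= 1 ->
    (@trans_expect _ _ _ P q T p xs
       (fun w ys => if (eps <= `|out w ys - xs|)%R then 1%E else 0%E) <= delta%:E)%E.

(* An adversary: randomness w' ~ P' on Omega', output a w' X_{1:T}; it sees
   only the queries.  Its strategy (a, P') is fixed in advance. *)
Definition adv_law (R : realType) (d : measure_display)
  (Omega : measurableType d) (P : probability Omega R)
  (q : nat -> Omega -> seq bool -> R) (T : nat) (p xs : R)
  (d' : measure_display) (Omega' : measurableType d') (P' : probability Omega' R)
  (a : Omega' -> seq R -> R) (B : set R) : \bar R :=
  @trans_expect _ _ _ P q T p xs
    (fun w ys => P' [set w' | B (a w' (@queries _ _ q T w ys))]).

(* Reasonable adversary: measurable in its own randomness, and its output is a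
   draw from a belief with uniform prior on the optimizer whose belief updates
   are consistent, i.e. when xs ~ Unif[0,1] the expected posterior (= the law of
   the output) equals the prior Unif[0,1]. *)
Definition reasonable_adversary (R : realType) (d : measure_display)
  (Omega : measurableType d) (P : probability Omega R)
  (q : nat -> Omega -> seq bool -> R) (T : nat) (p : R)
  (d' : measure_display) (Omega' : measurableType d') (P' : probability Omega' R)
  (a : Omega' -> seq R -> R) : Prop :=
  (forall xsq, measurable_fun setT (fun w' => a w' xsq)) /\
  (forall B : set R, measurable B ->
     (\int[@lebesgue_measure R]_(xs in `[0%R, 1%R])
         @adv_law _ _ _ P q T p xs _ _ P' a B)%E
     = (@lebesgue_measure R) (B `&` `[0%R, 1%R])).

Definition private (R : realType) (d : measure_display)
  (Omega : measurableType d) (P : probability Omega R)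
  (q : nat -> Omega -> seq bool -> R) (T : nat) (p eps_adv delta_adv : R)
  : Prop :=
  forall (d' : measure_display) (Omega' : measurableType d')
         (P' : probability Omega' R) (a : Omega' -> seq R -> R),
    @reasonable_adversary _ _ _ P q T p _ _ P' a ->
    forall xs : R, 0 <= xs <= 1 ->
      (@adv_law _ _ _ P q T p xs _ _ P' a [set x | (`|x - xs| <= eps_adv)%R]
         <= delta_adv%:E)%E.

Definition secure_algorithm (R : realType) (d : measure_display)
  (Omega : measurableType d) (P : probability Omega R)
  (q : nat -> Omega -> seq bool -> R) (out : Omega -> seq bool -> R)
  (T : nat) (p eps delta eps_adv delta_adv : R) : Prop :=
  learner_measurable q out /\
  @accurate _ _ _ P q out T p eps delta /\
  @private _ _ _ P q T p eps_adv delta_adv.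

Definition cp (R : realType) (p : R) : R := (2 * p - 1) * ln (p / (1 - p)).

(* Main.v *)
(* Cut [0, 1] into [m ~ 1 / (32 eps_adv)] bins. Averaged over a uniform
   optimizer, the expected shares of queries falling into the bins add up to at
   most 1, so some bin [J] receives at most its length. An adversary that
   samples from [J] with probability equal to the (suitably boosted) share of
   the queries lying in [J], and from the complement of [J] otherwise, is then
   reasonable, and for an optimizer [x] in [J] it succeeds with probability of
   the order of E_x[#queries in J] / T.
   On the other hand an answer carries information on the position of the
   optimizer within [J] only if the query lies in [J], and then at most [cp p]
   nats. Comparing, by a change of measure (Donsker-Varadhan), one of the
   [~ eps_adv / eps] candidates of [J] with another under which the learner
   rarely outputs it, accuracy forces
   cp p * E_x[#queries in J] >= (1 - delta) * ln (eps_adv / eps). *)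

Require Import Defs.
From HB Require Import structures.
From mathcomp Require Import all_boot all_order all_algebra.
From mathcomp Require Import all_classical all_reals all_analysis.
From mathcomp Require Import measurable_realfun ring lra.
Import Order.TTheory GRing.Theory Num.Theory.
Local Open Scope ring_scope.

Set Implicit Arguments.
Unset Strict Implicit.
Unset Printing Implicit Defensive.

(** * Finite transcripts and the change of measure between two optimizers *)

Lemma ln_le_sub1 {R : realType} (x : R) : 0 < x -> ln x <= x - 1.
Proof.
by move=> x0; have := @le_ln1Dx R (x - 1); rewrite (addrC 1) subrK; apply; lra.
Qed.

Section Transcripts.
Context {R : realType} {Omega : Type}.
Variables (q : nat -> Omega -> seq bool -> R) (p : R).

(** [F] is defined on all sequences and not only on [T]-tuples, so that one statistic can be read at
    the lengths [T] and [T.+1] in inductions on [T]. *)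
Definition transcript_mean (T : nat) (xs : R) (w : Omega)
    (F : seq bool -> R) : R :=
  \sum_(ys : T.-tuple bool) transcript_weight q p xs w ys * F ys.

(** Half-open intervals make consecutive bins disjoint and fit the oracle convention [xs <= x]: a
    query that separates two optimizers of [[c, d[] lies itself in [[c, d[]. *)
Definition hits (T : nat) (c d : R) (w : Omega) (ys : seq bool) : nat :=
  count (fun x => c <= x < d) (queries q T w ys).

Lemma sum_tuple_rcons (T : nat) (F : seq bool -> R) :
  \sum_(ys : T.+1.-tuple bool) F ys =
  \sum_(ys : T.-tuple bool) \sum_(b : bool) F (rcons ys b).
Proof.
rewrite pair_big /=.
pose h (u : T.-tuple bool * bool) := [tuple of rcons u.1 u.2].
have h_inj : injective h.
  move=> [u a] [v b] /(congr1 val) /= /rcons_inj [uv ->].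
  by congr pair; apply: val_inj.
have h_bij : bijective h.
  by apply: inj_card_bij => //; rewrite card_prod !card_tuple card_bool expnSr.
by rewrite (reindex h) //=; exact: onW_bij.
Qed.

Lemma transcript_weight_rcons (T : nat) (xs : R) (w : Omega)
    (ys : T.-tuple bool) (b : bool) :
  transcript_weight q p xs w [tuple of rcons ys b] =
  transcript_weight q p xs w ys * resp_prob p xs (q T w ys) b.
Proof.
rewrite /transcript_weight big_ord_recr /= -cats1; congr (_ * _).
  apply: eq_bigr => t _.
  rewrite takel_cat ?size_tuple ?(ltnW (ltn_ord t))//.
  by rewrite nth_cat size_tuple ltn_ord.
rewrite take_cat size_tuple ltnn subnn take0 cats0.
by rewrite nth_cat size_tuple ltnn subnn.
Qed.

(** Tower rule. The last answer is the one peeled off because a query depends only on the answers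
    before it, so the earlier factors do not change. *)
Lemma transcript_mean_rcons (T : nat) (xs : R) (w : Omega)
    (F : seq bool -> R) :
  transcript_mean T.+1 xs w F = transcript_mean T xs w
    (fun ys => \sum_(b : bool) resp_prob p xs (q T w ys) b * F (rcons ys b)).
Proof.
pose W (s : seq bool) : R :=
  \prod_(t < T.+1) resp_prob p xs (q t w (take t s)) (nth false s t).
rewrite /transcript_mean.
transitivity (\sum_(ys : T.+1.-tuple bool) W ys * F ys) => //.
rewrite (sum_tuple_rcons T (fun s => W s * F s)).
apply: eq_bigr => ys _; rewrite big_distrr /=; apply: eq_bigr => b _.
by rewrite mulrA -transcript_weight_rcons.
Qed.

Lemma sum_resp_prob (xs x : R) : \sum_(b : bool) resp_prob p xs x b = 1.
Proof. by rewrite big_bool /= /resp_prob; case: (sign_resp xs x) => /=; ring. Qed.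

Lemma hits_rcons (T : nat) (c d : R) (w : Omega) (ys : T.-tuple bool) b :
  hits T.+1 c d w (rcons ys b) =
  (hits T c d w ys + (c <= q T w ys < d)%R)%N.
Proof.
rewrite /hits /queries -[X in iota 0 X]addn1 iotaD map_cat count_cat /= addn0.
rewrite -cats1 take_cat size_tuple ltnn subnn take0 cats0; congr (_ + _)%N.
congr count; apply/eq_in_map => t; rewrite mem_iota add0n /= => tT.
by rewrite takel_cat ?size_tuple ?(ltnW tT).
Qed.

Lemma transcript_mean_ext (T : nat) (xs : R) (w : Omega) (F G : seq bool -> R) :
  (forall ys : T.-tuple bool, F ys = G ys) ->
  transcript_mean T xs w F = transcript_mean T xs w G.
Proof. by move=> FG; apply: eq_bigr => ys _; rewrite FG. Qed.

Lemma transcript_meanD (T : nat) (xs : R) (w : Omega) (F G : seq bool -> R) :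
  transcript_mean T xs w (fun ys => F ys + G ys) =
  transcript_mean T xs w F + transcript_mean T xs w G.
Proof.
by rewrite /transcript_mean -big_split; apply: eq_bigr => ys _; rewrite mulrDr.
Qed.

Lemma transcript_meanZ (T : nat) (xs : R) (w : Omega) (k : R)
    (F : seq bool -> R) :
  transcript_mean T xs w (fun ys => k * F ys) = k * transcript_mean T xs w F.
Proof.
by rewrite /transcript_mean big_distrr; apply: eq_bigr => ys _; rewrite mulrCA.
Qed.

Lemma transcript_mean_nil (xs : R) (w : Omega) (F : seq bool -> R) :
  transcript_mean 0 xs w F = F [::].
Proof.
rewrite /transcript_mean (bigD1 [tuple]) //= big1 ?addr0.
  by rewrite /transcript_weight big_ord0 mul1r.
by move=> ys /eqP []; exact: tuple0.
Qed.

Lemma transcript_mean_cst (T : nat) (xs : R) (w : Omega) (k : R) :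
  transcript_mean T xs w (fun=> k) = k.
Proof.
elim: T => [|T IH]; first exact: transcript_mean_nil.
rewrite transcript_mean_rcons -[RHS]IH; apply: transcript_mean_ext => ys.
by rewrite -big_distrl /= sum_resp_prob mul1r.
Qed.

Hypothesis p_itv : 1 / 2 < p < 1.

Lemma resp_prob_gt0 (xs x : R) b : 0 < resp_prob p xs x b.
Proof. by case/andP: p_itv => p1 p2; rewrite /resp_prob; case: ifP => _; lra. Qed.

Lemma transcript_weight_ge0 (T : nat) (xs : R) (w : Omega) (ys : T.-tuple bool) :
  0 <= transcript_weight q p xs w ys.
Proof. by apply: prodr_ge0 => t _; apply/ltW/resp_prob_gt0. Qed.

Lemma transcript_mean_le (T : nat) (xs : R) (w : Omega) (F G : seq bool -> R) :
  (forall ys : T.-tuple bool, F ys <= G ys) ->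
  transcript_mean T xs w F <= transcript_mean T xs w G.
Proof.
by move=> FG; apply: ler_sum => ys _; apply: ler_wpM2l => //; exact: transcript_weight_ge0.
Qed.

Lemma cp_gt0 : 0 < cp p.
Proof.
case/andP: p_itv => p1 p2; rewrite /cp mulr_gt0 //; first lra.
by rewrite ln_gt0 // ltr_pdivlMr; lra.
Qed.

(* Donsker-Varadhan for one answer: each summand is [r * ln u <= r * (u - 1)]
   with [u = r' * h b / (r * m)], where [m] is the mean of [h] under [r']. *)
Lemma ln_mean_one_answer (xs ys x : R) (h : bool -> R) :
  (forall b, 0 < h b) ->
  \sum_(b : bool) resp_prob p xs x b * ln (h b) <=
  ln (\sum_(b : bool) resp_prob p ys x b * h b)
  + (if sign_resp xs x == sign_resp ys x then 0 else cp p).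
Proof.
move=> h0; rewrite !big_bool /=.
have := resp_prob_gt0 ys x true; have := resp_prob_gt0 ys x false.
have := resp_prob_gt0 xs x true; have := resp_prob_gt0 xs x false.
case/andP: p_itv => p1 p2.
have lnp : ln (p / (1 - p)) = ln p - ln (1 - p).
  by rewrite ln_div // posrE; lra.
set r1 := resp_prob p xs x true; set r2 := resp_prob p xs x false.
set s1 := resp_prob p ys x true; set s2 := resp_prob p ys x false.
move=> r2p r1p s2p s1p.
set m := s1 * h true + s2 * h false.
have m0 : 0 < m by rewrite addr_gt0 // mulr_gt0.
have key (r s k : R) : 0 < r -> 0 < s -> 0 < k ->
    r * ln k <= r * (ln m + ln r - ln s) + (s * k / m - r).
  move=> r0 s0 k0.
  have u0 : 0 < s * k / (r * m) by rewrite divr_gt0 ?mulr_gt0.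
  have := ln_le_sub1 u0; rewrite ln_div ?posrE ?mulr_gt0 // !lnM ?posrE // => lnu.
  have -> : s * k / m - r = r * (s * k / (r * m) - 1).
    by field; rewrite !gt_eqF.
  by rewrite -mulrDr ler_pM2l //; lra.
have k1 := key _ _ _ r1p s1p (h0 true); have k2 := key _ _ _ r2p s2p (h0 false).
have mE : s1 * h true / m + s2 * h false / m = 1.
  by rewrite -mulrDl divff // gt_eqF.
have r12 : r1 + r2 = 1 by rewrite -(sum_resp_prob xs x) big_bool.
apply: le_trans (lerD k1 k2) _.
have -> : r1 * (ln m + ln r1 - ln s1) + (s1 * h true / m - r1)
    + (r2 * (ln m + ln r2 - ln s2) + (s2 * h false / m - r2)) =
  (r1 + r2) * ln m + r1 * (ln r1 - ln s1) + r2 * (ln r2 - ln s2)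
    + (s1 * h true / m + s2 * h false / m) - (r1 + r2) by ring.
(* What remains is the relative entropy of the two answer laws: it vanishes if the correct answers
   agree, and otherwise equals [p * ln (p / (1 - p)) + (1 - p) * ln ((1 - p) / p)], which is
   [cp p]. *)
rewrite r12 mE mul1r /r1 /r2 /s1 /s2 /resp_prob /cp lnp.
by case: (sign_resp xs x); case: (sign_resp ys x) => /=; lra.
Qed.

(** Donsker-Varadhan for whole transcripts, by induction on [T] with the one-answer bound at each
    query. Where the usual form has [ln m], [m] being the mean of [h], the bound has [m - 1]: this
    is affine in [m] and integrates over [w] term by term. *)
Lemma change_of_optimizer (T : nat) (c d xs ys : R) (w : Omega)
    (h : seq bool -> R) :
  c <= xs < d -> c <= ys < d -> (forall s, 0 < h s) ->
  transcript_mean T xs w (fun s => ln (h s)) <=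
  transcript_mean T ys w h - 1
  + cp p * transcript_mean T xs w (fun s => (hits T c d w s)%:R).
Proof.
move=> /andP[cx xd] /andP[cy yd].
elim: T h => [|T IH] h h0.
  rewrite !transcript_mean_nil /hits /= mulr0 addr0.
  exact: ln_le_sub1.
(* [h'] is the conditional mean of [h] under [ys] given the first [T] answers; the induction
   hypothesis is applied to it. *)
pose h' s := \sum_(b : bool) resp_prob p ys (q T w s) b * h (rcons s b).
have h'0 s : 0 < h' s.
  by rewrite /h' big_bool addr_gt0 // mulr_gt0 ?resp_prob_gt0.
have := IH h' h'0; rewrite !transcript_mean_rcons -/h' => IHh'.
apply: (@le_trans _ _ (transcript_mean T xs w (fun s => ln (h' s) +
    cp p * (c <= q T w s < d)%R%:R))).
  apply: transcript_mean_le => s.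
  pose hs b := h (rcons s b).
  apply: le_trans (ln_mean_one_answer xs ys (q T w s) (h := hs) _) _ => //.
    by move=> b; exact: h0.
  rewrite lerD2l; case: ifP => [_|]; first by rewrite mulr_ge0 // ltW // cp_gt0.
  (* Outside [[c, d[] a query has the same correct answer for both optimizers, so a cost [cp p] is
     always paid for by a hit. *)
  move=> /eqP neq; rewrite ler_peMr ?(ltW cp_gt0) // ler1n lt0b.
  apply: contra_notT neq => notin; rewrite /sign_resp.
  have [xq|xq] := leP xs (q T w s); have [yq|yq] := leP ys (q T w s) => //;
    case/negP: notin; lra.
rewrite transcript_meanD transcript_meanZ.
have -> : transcript_mean T xs w (fun s => \sum_(b : bool)
      resp_prob p xs (q T w s) b * (hits T.+1 c d w (rcons s b))%:R) =
    transcript_mean T xs w (fun s => (hits T c d w s)%:R) +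
    transcript_mean T xs w (fun s => (c <= q T w s < d)%R%:R).
  rewrite -transcript_meanD; apply: transcript_mean_ext => s.
  under eq_bigr => b _ do rewrite hits_rcons natrD.
  by rewrite -big_distrl /= sum_resp_prob mul1r.
by rewrite mulrDr; lra.
Qed.

End Transcripts.

(** * Bounded measurable functions *)

Section BoundedMeasurable.
Context d {T : measurableType d} {R : realType}.
Variable mu : {finite_measure set T -> \bar R}.

(** This class is closed under sums and products and integrable for every finite measure, so the
    integrability of a statistic can be read off from its form. *)
Definition bounded_measurable (f : T -> R) :=
  measurable_fun [set: T] f /\ exists K, forall x, `|f x| <= K.

Lemma bounded_measurable_integrable (D : set T) (f : T -> R) : measurable D ->
  bounded_measurable f -> mu.-integrable D (EFin \o f).
Proof.
move=> mD [mf [K fK]]; apply: measurable_bounded_integrable => //.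
- by rewrite -ge0_fin_numE // fin_num_measure.
- exact: measurable_funTS.
- exists K; split; first exact: num_real.
  by move=> L KL x _ /=; apply: le_trans (fK x) (ltW KL).
Qed.

Lemma bounded_measurable_cst (k : R) : bounded_measurable (fun=> k).
Proof. by split; [exact: measurable_cst|exists `|k|]. Qed.

Lemma bounded_measurableD (f g : T -> R) : bounded_measurable f ->
  bounded_measurable g -> bounded_measurable (fun x => f x + g x).
Proof.
move=> [mf [K fK]] [mg [L gL]]; split; first exact: measurable_funD.
by exists (K + L) => x; apply: le_trans (ler_normD _ _) (lerD (fK x) (gL x)).
Qed.

Lemma bounded_measurableM (f g : T -> R) : bounded_measurable f ->
  bounded_measurable g -> bounded_measurable (fun x => f x * g x).
Proof.
move=> [mf [K fK]] [mg [L gL]]; split; first exact: measurable_funM.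
by exists (K * L) => x; rewrite normrM ler_pM.
Qed.

Lemma bounded_measurable_sum (I : Type) (r : seq I) (f : I -> T -> R) :
  (forall i, bounded_measurable (f i)) ->
  bounded_measurable (fun x => \sum_(i <- r) f i x).
Proof.
move=> bf; elim: r => [|i r IH].
  by under eq_fun do rewrite big_nil; exact: bounded_measurable_cst.
by under eq_fun do rewrite big_cons; exact: bounded_measurableD.
Qed.

Lemma bounded_measurable_prod (I : Type) (r : seq I) (f : I -> T -> R) :
  (forall i, bounded_measurable (f i)) ->
  bounded_measurable (fun x => \prod_(i <- r) f i x).
Proof.
move=> bf; elim: r => [|i r IH].
  by under eq_fun do rewrite big_nil; exact: bounded_measurable_cst.
by under eq_fun do rewrite big_cons; exact: bounded_measurableM.
Qed.

Lemma bounded_measurable_bool (b : T -> bool) :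
  measurable_fun [set: T] b -> bounded_measurable (fun x => (b x)%:R).
Proof.
move=> mb; split; last by exists 1 => x; case: (b x); rewrite ?normr1 ?normr0.
rewrite (_ : (fun x => _) = (fun x => if b x then 1 else 0)); last first.
  by apply/funext => x; case: (b x).
exact: measurable_fun_ifT.
Qed.

End BoundedMeasurable.

Lemma bounded_measurable_comp d d' {T : measurableType d} {T' : measurableType d'}
    {R : realType} (f : T' -> R) (g : T -> T') :
  bounded_measurable f -> measurable_fun [set: T] g ->
  bounded_measurable (fun x => f (g x)).
Proof.
move=> [mf [K fK]] mg; split; last by exists K.
exact: measurableT_comp.
Qed.

(** * Expectations over the learner's randomness and the answers *)

Section Mean.
Context {R : realType} {d : measure_display} {Omega : measurableType d}.
Variable P : probability Omega R.
Variable q : nat -> Omega -> seq bool -> R.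
Variables (T : nat) (p : R).
Hypothesis mq : forall t ys, measurable_fun [set: Omega] (fun w => q t w ys).
Hypothesis p_itv : 1 / 2 < p < 1.

Definition mean (xs : R) (F : Omega -> seq bool -> R) : R :=
  \int[P]_w transcript_mean q p T xs w (F w).

Definition statistic (F : Omega -> seq bool -> R) :=
  forall ys, bounded_measurable (fun w => F w ys).

(** Measurability is joint in the randomness and the optimizer because expectations are later
    averaged over the optimizer. *)
Lemma bounded_measurable_transcript_mean (F : Omega -> seq bool -> R) :
  statistic F ->
  bounded_measurable
    (fun z : Omega * R => transcript_mean q p T z.2 z.1 (F z.1)).
Proof.
move=> sF; apply: bounded_measurable_sum => ys; apply: bounded_measurableM.
  apply: bounded_measurable_prod => t.
  have mb : measurable_fun [set: Omega * R]
      (fun z => nth false ys t == (z.2 <= q t z.1 (take t ys))).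
    rewrite (_ : (fun z : Omega * R => _) = (fun z : Omega * R =>
        if nth false ys t then z.2 <= q t z.1 (take t ys)
        else ~~ (z.2 <= q t z.1 (take t ys)))); last first.
      by apply/funext => z; case: (nth false ys t); case: (_ <= _).
    have mle : measurable_fun [set: Omega * R]
        (fun z => z.2 <= q t z.1 (take t ys)).
      apply: measurable_fun_ler; first exact: measurable_snd.
      exact: (measurableT_comp (mq t (take t ys)) measurable_fst).
    by case: (nth false ys t) => //; exact: measurable_neg.
  (* An answer probability is affine in the indicator that the answer is correct. *)
  rewrite (_ : (fun z : Omega * R => _) = (fun z : Omega * R =>
    (1 - p) + (2 * p - 1) * (nth false ys t == (z.2 <= q t z.1 (take t ys)))%:R)).
    apply: bounded_measurableD; first exact: bounded_measurable_cst.
    by apply: bounded_measurableM;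
      [exact: bounded_measurable_cst|exact: bounded_measurable_bool].
  by apply/funext => z; rewrite /resp_prob /sign_resp; case: (_ == _) => /=; ring.
exact: (bounded_measurable_comp (sF ys) measurable_fst).
Qed.

Lemma bounded_measurable_mean_integrand xs (F : Omega -> seq bool -> R) :
  statistic F ->
  bounded_measurable (fun w => transcript_mean q p T xs w (F w)).
Proof.
move=> sF; have := bounded_measurable_transcript_mean sF.
move=> /(bounded_measurable_comp (g := fun w => (w, xs))); apply.
exact: pair2_measurable.
Qed.

Let integrableT (f : Omega -> R) :
  bounded_measurable f -> P.-integrable [set: Omega] (EFin \o f).
Proof. exact: bounded_measurable_integrable. Qed.

(** Passage from the extended-real expectation of the definitions to a real number, on which linear
    arithmetic is available. *)
Lemma trans_expect_mean xs (F : Omega -> seq bool -> R) : statistic F ->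
  trans_expect P q p xs (fun w (ys : T.-tuple bool) => (F w ys)%:E) =
  (mean xs F)%:E.
Proof.
move=> sF; rewrite /trans_expect /mean /Rintegral fineK.
  by apply: eq_integral => w _; rewrite -sumEFin.
exact/integrable_fin_num/integrableT/bounded_measurable_mean_integrand.
Qed.

Lemma mean_ext xs (F G : Omega -> seq bool -> R) :
  (forall w (ys : T.-tuple bool), F w ys = G w ys) -> mean xs F = mean xs G.
Proof.
by move=> FG; apply: eq_Rintegral => w _; exact: transcript_mean_ext.
Qed.

Lemma meanD xs (F G : Omega -> seq bool -> R) : statistic F -> statistic G ->
  mean xs (fun w ys => F w ys + G w ys) = mean xs F + mean xs G.
Proof.
move=> sF sG; rewrite /mean -RintegralD //;
  [|exact/integrableT/bounded_measurable_mean_integrand..].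
by apply: eq_Rintegral => w _; exact: transcript_meanD.
Qed.

Lemma meanZ xs k (F : Omega -> seq bool -> R) : statistic F ->
  mean xs (fun w ys => k * F w ys) = k * mean xs F.
Proof.
move=> sF; rewrite /mean -RintegralZl //;
  last exact/integrableT/bounded_measurable_mean_integrand.
by apply: eq_Rintegral => w _; exact: transcript_meanZ.
Qed.

Lemma mean_cst xs (k : R) : mean xs (fun _ _ => k) = k.
Proof.
rewrite /mean; under eq_Rintegral do rewrite transcript_mean_cst.
rewrite Rintegral_cst //.
by rewrite (congr1 fine (probability_setT P)) mulr1.
Qed.

Lemma mean_sum xs (I : Type) (r : seq I) (F : I -> Omega -> seq bool -> R) :
  (forall i, statistic (F i)) ->
  mean xs (fun w ys => \sum_(i <- r) F i w ys) = \sum_(i <- r) mean xs (F i).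
Proof.
move=> sF; elim: r => [|i r IH].
  by rewrite big_nil -[RHS](mean_cst xs); apply: mean_ext => w ys; rewrite big_nil.
have sS : statistic (fun w ys => \sum_(i <- r) F i w ys).
  by move=> ys; apply: bounded_measurable_sum => j; exact: sF.
rewrite big_cons -IH -meanD //.
by apply: mean_ext => w ys; rewrite big_cons.
Qed.

Lemma mean_le xs (F G : Omega -> seq bool -> R) : statistic F -> statistic G ->
  (forall w ys, F w ys <= G w ys) -> mean xs F <= mean xs G.
Proof.
move=> sF sG FG; apply: le_Rintegral => //;
  [exact/integrableT/bounded_measurable_mean_integrand..|].
by move=> w _; exact: transcript_mean_le.
Qed.

Lemma bounded_measurable_mean (F : Omega -> seq bool -> R) : statistic F ->
  (forall w ys, 0 <= F w ys) -> (exists K, forall w ys, F w ys <= K) ->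
  bounded_measurable (mean ^~ F).
Proof.
move=> sF F0 [K FK]; split; last first.
  exists K => xs; rewrite ger0_norm.
    rewrite -(mean_cst xs K); apply: mean_le => // ys.
    exact: bounded_measurable_cst.
  rewrite -(mean_cst xs 0); apply: mean_le => // ys.
  exact: bounded_measurable_cst.
have [mf _] := bounded_measurable_transcript_mean sF.
pose f (z : Omega * R) := (transcript_mean q p T z.2 z.1 (F z.1))%:E.
have mf' : measurable_fun [set: Omega * R] f by exact/measurable_EFinP.
have f0 z : (0 <= f z)%E.
  by rewrite lee_fin; apply: sumr_ge0 => ys _; rewrite mulr_ge0 // transcript_weight_ge0.
(* Tonelli: the integral over [w] of a nonnegative jointly measurable function is measurable in the
   optimizer. *)
have mG := measurable_fun_fubini_tonelli_G (m1 := P) f mf' f0.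
exact: (measurableT_comp (fine_measurable measurableT) mG).
Qed.

End Mean.

(** * Accuracy forces many queries near the optimizer *)

Lemma sum_bool_le1 {R : numDomainType} (I : finType) (b : I -> bool) :
  (forall i j, b i -> b j -> i = j) -> \sum_i (b i)%:R <= 1 :> R.
Proof.
move=> b_inj; have [i bi|b0] := pickP b; last first.
  by rewrite big1 // => i _; rewrite b0.
rewrite (bigD1 i) //= bi big1 ?addr0 // => j ji.
by case bj: (b j) => //; rewrite (b_inj _ _ bj bi) eqxx in ji.
Qed.

Lemma pigeonhole {R : realFieldType} (n : nat) (f : 'I_n -> R) : (0 < n)%N ->
  \sum_i f i <= 1 -> exists i, f i <= n%:R^-1.
Proof.
move=> n0 sf; apply/existsP; apply: contraT; rewrite negb_exists => /forallP fn.
suff : 1 < \sum_i f i by rewrite ltNge sf.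
have -> : 1 = \sum_(i < n) n%:R^-1 :> R.
  by rewrite sumr_const card_ord -[RHS]mulr_natl divff // pnatr_eq0 -lt0n.
case: n n0 f {sf} fn => // n _ f fn.
apply: ltr_sum => [|i _]; last by rewrite ltNge.
by apply/hasP; exists ord0; rewrite ?mem_index_enum.
Qed.

Section HitsLowerBound.
Context {R : realType} {d : measure_display} {Omega : measurableType d}.
Variable P : probability Omega R.
Variable q : nat -> Omega -> seq bool -> R.
Variable out : Omega -> seq bool -> R.
Variables (T : nat) (p : R).
Hypothesis mq : forall t ys, measurable_fun [set: Omega] (fun w => q t w ys).
Hypothesis mout : forall ys, measurable_fun [set: Omega] (fun w => out w ys).
Hypothesis p_itv : 1 / 2 < p < 1.

Definition hit_count (a b : R) (w : Omega) (ys : seq bool) : R :=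
  (hits q T a b w ys)%:R.

Definition near (eps x : R) (w : Omega) (ys : seq bool) : R :=
  (`|out w ys - x| < eps)%R%:R.

Lemma hit_countE a b w ys :
  hit_count a b w ys =
  \sum_(t <- iota 0 T) (a <= q t w (take t ys) < b)%R%:R.
Proof.
rewrite /hit_count /hits /queries count_map -sum1_count natr_sum big_mkcond /=.
by apply: eq_bigr => t _; case: ifP.
Qed.

Lemma hit_count_le a b w ys : hit_count a b w ys <= T%:R.
Proof.
by rewrite /hit_count ler_nat /hits (leq_trans (count_size _ _)) // size_map size_iota.
Qed.

Lemma statistic_hit_count a b : statistic (hit_count a b).
Proof.
move=> ys; rewrite (_ : (fun w => _) = (fun w =>
    \sum_(t <- iota 0 T) (a <= q t w (take t ys) < b)%R%:R)); last first.
  by apply/funext => w; exact: hit_countE.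
apply: bounded_measurable_sum => t; apply: bounded_measurable_bool.
apply: measurable_and; first exact: measurable_fun_ler.
exact: measurable_fun_ltr.
Qed.

Lemma statistic_near eps x : statistic (near eps x).
Proof.
move=> ys; apply: bounded_measurable_bool; apply: measurable_fun_ltr => //.
by apply: measurableT_comp => //; exact: measurable_funB.
Qed.

Lemma mean_change_of_optimizer (a b x y : R) (h : Omega -> seq bool -> R) :
  a <= x < b -> a <= y < b -> (forall w ys, 0 < h w ys) ->
  statistic h -> statistic (fun w ys => ln (h w ys)) ->
  mean P q T p x (fun w ys => ln (h w ys)) <=
  mean P q T p y h - 1 + cp p * mean P q T p x (hit_count a b).
Proof.
move=> xab yab h0 sh slnh.
have sH := statistic_hit_count a b.
pose f z F w := transcript_mean q p T z w (F w).
have bf z F : statistic F -> bounded_measurable (f z F).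
  exact: bounded_measurable_mean_integrand.
have bf' z F (sF : statistic F) :=
  bounded_measurable_integrable P measurableT (bf z F sF).
have sh1 : statistic (fun w ys => h w ys + (-1)).
  by move=> ys; apply: bounded_measurableD => //; exact: bounded_measurable_cst.
have sHc : statistic (fun w ys => cp p * hit_count a b w ys).
  by move=> ys; apply: bounded_measurableM => //; exact: bounded_measurable_cst.
have s1 : statistic (fun (_ : Omega) (_ : seq bool) => -1 : R).
  by move=> ys; exact: bounded_measurable_cst.
have := @mean_cst _ _ _ P q T p y (-1) => <-.
rewrite -meanD // -meanZ // /mean -RintegralD //; [|exact: bf'..].
apply: le_Rintegral => //; first exact: bf'.
  exact: bounded_measurable_integrable (bounded_measurableD (bf _ _ sh1) (bf _ _ sHc)).
move=> w _; have := change_of_optimizer q p_itv T w xab yab (h0 w).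
by rewrite transcript_meanD transcript_mean_cst transcript_meanZ.
Qed.

(** The test function [h] is [M / 2] if the output is near [x] and [1 / 2] otherwise. Its mean under
    [y] is at most 1, since that event has probability at most [M^-1], so the term [mean - 1] is not
    positive; under [x] the mean of [ln h] is at least [(1 - delta) * ln M - ln 2]. *)
Lemma hits_lower_bound (a b x y eps delta M : R) :
  a <= x < b -> a <= y < b -> 1 <= M ->
  1 - delta <= mean P q T p x (near eps x) ->
  mean P q T p y (near eps x) <= M^-1 ->
  (1 - delta) * ln M - ln 2 <= cp p * mean P q T p x (hit_count a b).
Proof.
move=> xab yab M1 accx misy.
have M0 : 0 < M by lra.
pose h w ys := 2^-1 + (M - 1) / 2 * near eps x w ys.
have h0 w ys : 0 < h w ys.
  by rewrite /h /near; case: (_ < eps) => /=; lra.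
have sN := statistic_near eps x.
have scM k : statistic (fun w ys => k * near eps x w ys).
  by move=> ys; apply: bounded_measurableM => //; exact: bounded_measurable_cst.
have sc k : statistic (fun (_ : Omega) (_ : seq bool) => k : R).
  by move=> ys; exact: bounded_measurable_cst.
have sh : statistic h by move=> ys; apply: bounded_measurableD (sc _ ys) (scM _ ys).
have lnhE : (fun w ys => ln (h w ys)) =
    (fun w ys => - ln 2 + ln M * near eps x w ys).
  apply/funext => w; apply/funext => ys; rewrite /h /near.
  case: (_ < eps) => /=; last by rewrite !mulr0 !addr0 lnV // posrE.
  rewrite !mulr1 (_ : 2^-1 + (M - 1) / 2 = M / 2); last by field.
  by rewrite ln_div ?posrE // addrC.
have slnh : statistic (fun w ys => ln (h w ys)).
  by rewrite lnhE => ys; apply: bounded_measurableD (sc _ ys) (scM _ ys).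
have := mean_change_of_optimizer xab yab h0 sh slnh.
rewrite lnhE /h !meanD // !meanZ // !mean_cst => main.
have lnM : 0 <= ln M by rewrite ln_ge0.
have := ler_wpM2l lnM accx.
have M12 : 0 <= (M - 1) / 2 by lra.
have := ler_wpM2l M12 misy.
have -> : (M - 1) / 2 * M^-1 = 2^-1 - M^-1 / 2 by field; rewrite gt_eqF.
have : 0 < M^-1 by rewrite invr_gt0.
lra.
Qed.

(** The events of being close to the different candidates exclude each other, so their probabilities
    under the one optimizer [y] add up to at most 1. *)
Lemma exists_rarely_output (y eps : R) (x : nat -> R) (M : nat) :
  (0 < M)%N ->
  (forall i j z, `|z - x i| < eps -> `|z - x j| < eps -> i = j) ->
  exists2 k, (k < M)%N & mean P q T p y (near eps (x k)) <= M%:R^-1.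
Proof.
move=> M0 sep.
have sN i : statistic (near eps (x i)) by exact: statistic_near.
have le1 : \sum_(i < M) mean P q T p y (near eps (x i)) <= 1.
  rewrite -mean_sum // -[leRHS](@mean_cst _ _ _ P q T p y).
  apply: mean_le => // [ys|ys|w ys].
  - by apply: bounded_measurable_sum => i; exact: sN.
  - exact: bounded_measurable_cst.
  - by apply: sum_bool_le1 => i j xi xj; apply: val_inj; exact: sep xi xj.
have [k kM] := pigeonhole M0 le1.
by exists k.
Qed.

End HitsLowerBound.

(** * Drawing from one of two laws with a prescribed bias *)

Lemma mnormalize_finite d (T : measurableType d) (R : realType)
    (mu : {measure set T -> \bar R}) (P : probability T R) (B : set T) (l : R) :
  0 < l -> mu [set: T]%classic = l%:E ->
  mnormalize mu P B = (mu B * l^-1%:E)%E.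
Proof. by move=> l0 muT; rewrite /mnormalize muT eqe gt_eqF. Qed.

Section Mixture.
Context {d d1 d2 : measure_display} {R : realType}.
Context {Z : measurableType d} {A : measurableType d1} {X : measurableType d2}.
Variables (S : probability A R) (Q : probability X R).
Variables (b : A -> bool) (f g : X -> Z).
Hypothesis mb : measurable_fun [set: A] b.
Hypothesis mf : measurable_fun [set: X] f.
Hypothesis mg : measurable_fun [set: X] g.
Local Open Scope classical_set_scope.

Definition mixture (w : A * X) : Z := if b w.1 then f w.2 else g w.2.

Lemma measurable_mixture : measurable_fun setT mixture.
Proof.
apply: measurable_fun_ifT.
- exact: (measurableT_comp mb measurable_fst).
- exact: (measurableT_comp mf measurable_snd).
- exact: (measurableT_comp mg measurable_snd).
Qed.

(** The coin and the draw are independent, and the event is a disjoint union of two rectangles, one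
    for each outcome of the coin. *)
Lemma mixture_law (r : R) (B : set Z) : S [set a | b a] = r%:E -> measurable B ->
  (S \x Q)%E [set w | B (mixture w)] =
  (r%:E * Q (f @^-1` B) + (1 - r)%:E * Q (g @^-1` B))%E.
Proof.
move=> Sr mB.
have mA : measurable [set a | b a].
  by have := mb measurableT (Y := [set true]) I; rewrite setTI.
have mC : measurable (~` [set a | b a]) by exact: measurableC.
have mfB : measurable (f @^-1` B) by rewrite -[_ @^-1` _]setTI; exact: mf.
have mgB : measurable (g @^-1` B) by rewrite -[_ @^-1` _]setTI; exact: mg.
rewrite (_ : [set w | _] = ([set a | b a] `*` (f @^-1` B)) `|`
    (~` [set a | b a] `*` (g @^-1` B))); last first.
  apply/seteqP; split => -[a x] /=; rewrite /mixture /=.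
    by case: ifP => ba Bz; [left|right].
  by move=> [[-> //]|[/negP/negbTE -> //]].
rewrite measureU; [|exact: measurableX..|]; last first.
  by apply/seteqP; split => // -[a x] /= [[ba _] [nba _]].
have SC : S (~` [set a | b a]) = (1 - r)%:E by rewrite probability_setC // Sr EFinB.
by rewrite /= !product_measure1E //; congr (_ * _ + _ * _)%E.
Qed.

End Mixture.

Section Randomization.
Context {R : realType}.
Local Open Scope classical_set_scope.
Notation lambda := (@lebesgue_measure R).
Notation RR := (measurableTypeR R).

Lemma exists_uniform_probability (D : set R) (l : R) : measurable D -> 0 < l ->
  lambda D = l%:E ->
  exists U : probability RR R, forall B, U B = (lambda (B `&` D) * l^-1%:E)%E.
Proof.
move=> mD l0 lD.
(* The uniform law is the default value of [mnormalize] for a total mass zero or infinite; here the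
   mass is [l]. *)
exists (mnormalize (mrestr lambda mD) (uniform_prob (@ltr01 R))) => B.
have mT : mrestr lambda mD [set: RR] = l%:E.
  by rewrite -lD /mrestr; congr (lambda _); exact: setTI.
exact: (mnormalize_finite (mu := mrestr lambda mD) _ B l0 mT).
Qed.

Lemma lebesgue_unit_le (r : R) : 0 <= r <= 1 ->
  lambda ([set u | u <= r] `&` `[0%R, 1%R]) = r%:E.
Proof.
move=> /andP[r0 r1].
rewrite (_ : _ `&` _ = `[0%R, r]).
  by rewrite lebesgue_measure_itv /= lte_fin; case: ltgtP r0 => // [r0|<-] _;
    rewrite ?sube0.
apply/seteqP; split => u /=; rewrite !in_itv /=; first by move=> [-> /andP[->]].
by move=> /andP[-> ur]; split => //; exact: le_trans ur r1.
Qed.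

(** The law [W] does not depend on [r]: an adversary fixes its randomness in advance, while its bias
    depends on the queries it sees. The coin of bias [r] is the comparison of a uniform variable
    with [r]. *)
Lemma exists_mixture (U V : probability RR R) :
  exists (W : probability (RR * (RR * RR))%type R)
         (mix : R -> RR * (RR * RR) -> R),
    (forall r, measurable_fun setT (mix r)) /\
    forall r B, 0 <= r <= 1 -> measurable B ->
      W [set w | B (mix r w)] = (r%:E * U B + (1 - r)%:E * V B)%E.
Proof.
have l01 : lambda `[0%R, 1%R] = 1%:E.
  by rewrite lebesgue_measure_itv /= lte_fin ltr01 sube0.
have [S SE] := exists_uniform_probability (measurable_itv _) (@ltr01 R) l01.
pose b (r : R) (u : RR) := (u : R) <= r.
pose idR (x : RR) : R := x.
have midR : measurable_fun [set: RR] idR by exact: measurable_id.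
have mb r : measurable_fun [set: RR] (b r).
  by apply: measurable_fun_ler; [exact: midR|exact: measurable_cst].
pose Q : probability (RR * RR)%type R := (U \x V)%E.
have mf : measurable_fun [set: RR * RR] (idR \o fst).
  exact: measurableT_comp midR measurable_fst.
have mg : measurable_fun [set: RR * RR] (idR \o snd).
  exact: measurableT_comp midR measurable_snd.
exists (S \x Q)%E, (fun r => mixture (b r) (idR \o fst) (idR \o snd)).
split=> [r|r B r01 mB]; first exact: measurable_mixture.
have Sr : S [set u | b r u] = r%:E.
  by rewrite SE -[RHS](lebesgue_unit_le r01) invr1 mule1.
have mB' : measurable (B : set RR) by exact: mB.
have QU : Q ((idR \o fst) @^-1` B) = U B.
  rewrite (_ : _ @^-1` _ = (B : set RR) `*` [set: RR]); last first.
    by apply/seteqP; split => -[x y] //= [].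
  rewrite /Q /= product_measure1E // -[RHS]mule1.
  by congr (_ * _)%E; exact: (probability_setT V).
have QV : Q ((idR \o snd) @^-1` B) = V B.
  rewrite (_ : _ @^-1` _ = [set: RR] `*` (B : set RR)); last first.
    by apply/seteqP; split => -[x y] //= [].
  rewrite /Q /= product_measure1E // -[RHS]mul1e.
  by congr (_ * _)%E; exact: (probability_setT U).
by rewrite -QU -QV; exact: (mixture_law Q (mb r) mf mg Sr mB).
Qed.

End Randomization.

(** * Averages over a uniform optimizer *)

Section UnitIntegral.
Context {R : realType}.
Local Open Scope classical_set_scope.
Notation lambda := (@lebesgue_measure R).

Lemma unit_measure : lambda `[0%R, 1%R] = 1%:E.
Proof. by rewrite lebesgue_measure_itv /= lte_fin ltr01 sube0. Qed.

Lemma unit_integrable (f : R -> R) : bounded_measurable f ->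
  lambda.-integrable `[0%R, 1%R] (EFin \o f).
Proof.
move=> [mf [K fK]]; apply: measurable_bounded_integrable.
- exact: measurable_itv.
- by rewrite [ltLHS]unit_measure ltry.
- exact: measurable_funTS mf.
- exists K; split; first exact: num_real.
  by move=> L KL x _ /=; apply: le_trans (fK x) (ltW KL).
Qed.

Definition unit_average (f : R -> R) : R := \int[lambda]_(x in `[0%R, 1%R]) f x.

Lemma unit_average_cst (k : R) : unit_average (fun=> k) = k.
Proof.
by rewrite /unit_average Rintegral_cst // (congr1 fine unit_measure) mulr1.
Qed.

Lemma unit_averageD (f g : R -> R) : bounded_measurable f ->
  bounded_measurable g ->
  unit_average (fun x => f x + g x) = unit_average f + unit_average g.
Proof. by move=> bf bg; apply: RintegralD => //; exact: unit_integrable. Qed.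

Lemma unit_averageZ (k : R) (f : R -> R) : bounded_measurable f ->
  unit_average (fun x => k * f x) = k * unit_average f.
Proof. by move=> bf; apply: RintegralZl => //; exact: unit_integrable. Qed.

Lemma unit_average_le (f g : R -> R) : bounded_measurable f ->
  bounded_measurable g -> (forall x, f x <= g x) ->
  unit_average f <= unit_average g.
Proof. by move=> bf bg fg; apply: le_Rintegral => //; exact: unit_integrable. Qed.

Lemma unit_average_sum (I : Type) (r : seq I) (f : I -> R -> R) :
  (forall i, bounded_measurable (f i)) ->
  unit_average (fun x => \sum_(i <- r) f i x) = \sum_(i <- r) unit_average (f i).
Proof.
move=> bf; elim: r => [|i r IH].
  rewrite big_nil -[RHS](unit_average_cst 0); congr unit_average.
  by apply/funext => x; rewrite big_nil.
rewrite big_cons -IH -unit_averageD //; last exact: bounded_measurable_sum.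
by congr unit_average; apply/funext => x; rewrite big_cons.
Qed.

(** The law of the constructed adversary is affine in the mean share of queries in the bin; this
    form serves to average it over the optimizer. *)
Lemma unit_integral_affine (k l : R) (f : R -> R) : bounded_measurable f ->
  (\int[lambda]_(x in `[0%R, 1%R]) (k + l * f x)%:E)%E =
  (k + l * unit_average f)%:E.
Proof.
move=> bf.
have bl : bounded_measurable (fun x : R => l * f x).
  by apply: bounded_measurableM => //; exact: bounded_measurable_cst.
have bkl : bounded_measurable (fun x : R => k + l * f x).
  by apply: bounded_measurableD => //; exact: bounded_measurable_cst.
rewrite -unit_averageZ // -[X in (X + _)%:E]unit_average_cst -unit_averageD //;
  last exact: bounded_measurable_cst.
by rewrite /unit_average /Rintegral fineK //; exact/integrable_fin_num/unit_integrable.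
Qed.

End UnitIntegral.

(** * The adversary attached to a bin, and the choice of the bin *)

Section Adversary.
Context {R : realType} {d : measure_display} {Omega : measurableType d}.
Variable P : probability Omega R.
Variable q : nat -> Omega -> seq bool -> R.
Variables (T : nat) (p : R).
Hypothesis mq : forall t ys, measurable_fun [set: Omega] (fun w => q t w ys).
Hypothesis p_itv : 1 / 2 < p < 1.
Local Open Scope classical_set_scope.
Notation lambda := (@lebesgue_measure R).

Definition mean_share (a b x : R) : R :=
  mean P q T p x (fun w ys => T%:R^-1 * hit_count q T a b w ys).

Lemma share_itv a b w ys : 0 <= T%:R^-1 * hit_count q T a b w ys <= 1.
Proof.
rewrite mulr_ge0 ?invr_ge0 ?ler0n //=.
have [->|T0] := posnP T; first by rewrite invr0 mul0r ler01.
rewrite mulrC ler_pdivrMr ?ltr0n // mul1r; exact: hit_count_le.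
Qed.

Lemma statistic_share a b :
  statistic (fun w ys => T%:R^-1 * hit_count q T a b w ys).
Proof.
move=> ys; apply: bounded_measurableM; first exact: bounded_measurable_cst.
exact: statistic_hit_count.
Qed.

Lemma mean_hit_count a b x :
  mean P q T p x (hit_count q T a b) = T%:R * mean_share a b x.
Proof.
rewrite /mean_share -meanZ //; last exact: statistic_share.
apply: mean_ext => w ys; have [T0|T0] := posnP T.
  (* Without queries [T%:R^-1] is 0, but then the hit count is 0 as well. *)
  by move: (tval ys) => s; rewrite T0 mul0r /hit_count /hits /queries.
by rewrite mulrA mulfV ?mul1r // pnatr_eq0 -lt0n.
Qed.

Lemma mean_share_ge0 a b x : 0 <= mean_share a b x.
Proof.
rewrite -[leLHS](@mean_cst _ _ _ P q T p x); apply: mean_le => //.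
- by move=> ys; exact: bounded_measurable_cst.
- exact: statistic_share.
- by move=> w ys; have /andP[] := share_itv a b w ys.
Qed.

Lemma mean_share_le1 a b x : mean_share a b x <= 1.
Proof.
rewrite -[leRHS](@mean_cst _ _ _ P q T p x); apply: mean_le => //.
- exact: statistic_share.
- by move=> ys; exact: bounded_measurable_cst.
- by move=> w ys; have /andP[] := share_itv a b w ys.
Qed.

Lemma bounded_measurable_mean_share a b : bounded_measurable (mean_share a b).
Proof.
apply: bounded_measurable_mean => //.
- exact: statistic_share.
- by move=> w ys; have /andP[] := share_itv a b w ys.
- by exists 1 => w ys; have /andP[] := share_itv a b w ys.
Qed.

(* Given queries [s], the adversary draws from [[a, b[] with probability [r s]
   and from [[0, 1] `\` [a, b[] otherwise, where [r s] is the share of queries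
   in [[a, b[], boosted so that its average is exactly [b - a]; this makes the
   averaged output uniform. *)
Lemma private_mean_share (eps_adv delta_adv a b x : R) :
  private P q T p eps_adv delta_adv ->
  0 <= a -> b <= 1 -> 0 < b - a < 1 -> 0 < eps_adv ->
  unit_average (mean_share a b) <= b - a ->
  a <= x -> x + eps_adv <= b ->
  mean_share a b x * (eps_adv / (b - a)) <= delta_adv.
Proof.
move=> priv a0 b1 /andP[l0 l1] e0 nu_le ax xb.
set nu := unit_average (mean_share a b) in nu_le.
set l := b - a in l0 l1 nu_le *.
have nu0 : 0 <= nu.
  rewrite -(unit_average_cst (0 : R)); apply: unit_average_le => [||y].
  - exact: bounded_measurable_cst.
  - exact: bounded_measurable_mean_share.
  - exact: mean_share_ge0.
(* [alpha] solves [alpha + (1 - alpha) * nu = l]; it is nonnegative because the average share [nu]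
   is at most the length [l]. *)
pose alpha := (l - nu) / (1 - nu).
have alpha0 : 0 <= alpha by rewrite divr_ge0 //; lra.
have alpha1 : alpha <= 1 by rewrite ler_pdivrMr; lra.
pose J : set R := `[a, b[; pose K : set R := `[0%R, 1%R] `\` J.
have mJ : measurable J by exact: measurable_itv.
have mK : measurable K by apply: measurableD => //; exact: measurable_itv.
have JI : J `<=` `[0%R, 1%R].
  by move=> y; rewrite /J /= !in_itv /= => /andP[ay yb]; lra.
have lJ : lambda J = l%:E.
  by rewrite /J lebesgue_measure_itv /= lte_fin ifT -?EFinB //; lra.
have split_unit (B : set R) : measurable B ->
    lambda (B `&` `[0%R, 1%R]) = (lambda (B `&` J) + lambda (B `&` K))%E.
  move=> mB; rewrite -measureU //.
  - by rewrite -setIUr /K setDUK.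
  - exact: measurableI.
  - exact: measurableI.
  - by apply/seteqP; split => // y [[_ yJ] [_ [_]]].
have lK : lambda K = (1 - l)%:E.
  have := split_unit setT measurableT; rewrite !setTI unit_measure lJ.
  by move=> E; rewrite EFinB E [X in (X - _)%E]addeC addeK.
have [U UE] := exists_uniform_probability mJ l0 lJ.
have l1' : 0 < 1 - l by lra.
have [V VE] := exists_uniform_probability mK l1' lK.
have [W [mix [mmix WE]]] := exists_mixture U V.
pose r (s : seq R) :=
  alpha + (1 - alpha) * (T%:R^-1 * (count (fun y => a <= y < b)%R s)%:R).
have lawE y (B : set R) : measurable B ->
    adv_law P q T p y W (fun w' s => mix (r s) w') B =
    ((fine (V B) + alpha * (fine (U B) - fine (V B))) +
     (1 - alpha) * (fine (U B) - fine (V B)) * mean_share a b y)%:E.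
  move=> mB; rewrite /mean_share -meanZ //; last exact: statistic_share.
  rewrite -[X in (X + _)%:E](@mean_cst _ _ _ P q T p y) -meanD //; first last.
  - move=> ys; apply: bounded_measurableM; first exact: bounded_measurable_cst.
    exact: statistic_share.
  - by move=> ys; exact: bounded_measurable_cst.
  rewrite -trans_expect_mean //; last first.
    move=> ys; apply: bounded_measurableD; first exact: bounded_measurable_cst.
    apply: bounded_measurableM; first exact: bounded_measurable_cst.
    exact: statistic_share.
  rewrite /adv_law; congr trans_expect; apply/funext => w; apply/funext => ys.
  have /andP[s0 s1] := share_itv a b w ys.
  have r01 : 0 <= r (queries q T w ys) <= 1.
    by rewrite /r -/(hits q T a b w ys) -/(hit_count q T a b w ys); nra.
  rewrite WE // -[U B]fineK ?fin_num_measure // -[V B]fineK ?fin_num_measure //.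
  rewrite -!EFinM -EFinD; congr (_%:E).
  by rewrite /r -/(hits q T a b w ys) -/(hit_count q T a b w ys); ring.
(* By the choice of [alpha], the averaged law is [l * U + (1 - l) * V], which is Lebesgue measure on
   [J] plus Lebesgue measure on [K]. *)
have reas : reasonable_adversary P q T p W (fun w' s => mix (r s) w').
  split=> [s|B mB]; first exact: mmix.
  under eq_integral do rewrite lawE //.
  rewrite unit_integral_affine; last exact: bounded_measurable_mean_share.
  rewrite split_unit //.
  have UB : lambda (B `&` J) = (l * fine (U B))%:E.
    rewrite EFinM fineK ?fin_num_measure // UE muleCA -EFinM mulfV ?mule1 //.
    by rewrite gt_eqF.
  have VB : lambda (B `&` K) = ((1 - l) * fine (V B))%:E.
    rewrite EFinM fineK ?fin_num_measure // VE muleCA -EFinM mulfV ?mule1 //.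
    by rewrite gt_eqF.
  rewrite UB VB -EFinD -/nu; congr (_%:E).
  by rewrite /alpha; field; lra.
have x01 : 0 <= x <= 1 by lra.
have := priv _ _ W _ reas x x01.
set B := [set y : R | _ ].
have BE : B = `[x - eps_adv, x + eps_adv].
  by apply/seteqP; split => y; rewrite /B /= in_itv /= ler_distl.
have mB : measurable B by rewrite BE; exact: measurable_itv.
rewrite lawE // lee_fin; apply: le_trans.
(* Only the right half [[x, x + eps_adv[] of the target is sure to lie in [J]. *)
have U_ge : eps_adv / l <= fine (U B).
  rewrite -lee_fin fineK ?fin_num_measure // UE EFinM.
  apply: lee_wpmul2r; first by rewrite lee_fin invr_ge0 ltW.
  have <- : lambda `[x, x + eps_adv[ = eps_adv%:E.
    by rewrite lebesgue_measure_itv /= lte_fin ifT -?EFinB ?ltrDl // addrAC subrr add0r.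
  apply: le_measure; rewrite ?inE; [exact: measurable_itv|exact: measurableI|].
  move=> y; rewrite BE /J /= !in_itv /= => /andP[xy yx].
  by split; apply/andP; split; lra.
have V0 : 0 <= fine (V B) by rewrite fine_ge0.
have s0 := mean_share_ge0 a b x; have s1 := mean_share_le1 a b x.
have U0 : 0 <= fine (U B) by rewrite fine_ge0.
(* The boost only raises the probability of drawing from [U], and draws from [V] can only add to the
   success probability. *)
apply: (@le_trans _ _ (mean_share a b x * fine (U B))); first exact: ler_wpM2l.
have s1' : 0 <= 1 - mean_share a b x by lra.
have alpha1' : 0 <= 1 - alpha by lra.
have U1 := mulr_ge0 (mulr_ge0 alpha0 s1') U0.
have V1 := mulr_ge0 (mulr_ge0 alpha1' s1') V0.
rewrite -subr_ge0; apply: le_trans (addr_ge0 U1 V1) _.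
by rewrite le_eqVlt; apply/orP; left; apply/eqP; ring.
Qed.

(** The bins are disjoint, so each query counts in at most one of them and the shares add up to at
    most 1; a query at 1 counts in none. *)
Lemma exists_rarely_hit_bin (m : nat) : (0 < m)%N ->
  exists i : 'I_m,
    unit_average (mean_share (i%:R / m%:R) (i.+1%:R / m%:R)) <= m%:R^-1.
Proof.
move=> m0; apply: pigeonhole => //.
have mR0 : 0 < m%:R :> R by rewrite ltr0n.
rewrite -unit_average_sum; last by move=> i; exact: bounded_measurable_mean_share.
rewrite -[leRHS](unit_average_cst (1 : R)); apply: unit_average_le => [||x].
- by apply: bounded_measurable_sum => i; exact: bounded_measurable_mean_share.
- exact: bounded_measurable_cst.
rewrite -mean_sum //; last by move=> i; exact: statistic_share.
rewrite -[leRHS](@mean_cst _ _ _ P q T p x); apply: mean_le => //.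
- by move=> ys; apply: bounded_measurable_sum => i; exact: statistic_share.
- by move=> ys; exact: bounded_measurable_cst.
move=> w ys; rewrite -big_distrr /=.
have [->|T0] := posnP T; first by rewrite invr0 mul0r ler01.
rewrite mulrC ler_pdivrMr ?ltr0n // mul1r.
under eq_bigr do rewrite hit_countE.
rewrite exchange_big /=.
have -> : T%:R = \sum_(t <- iota 0 T) 1 :> R by rewrite big_const_seq count_predT
  size_iota iter_addr_0.
apply: ler_sum => t _; apply: sum_bool_le1 => i j.
rewrite !ler_pdivrMr // !ltr_pdivlMr // => /andP[i1 i2] /andP[j1 j2].
have ij : (i < j.+1)%N by rewrite -(ltr_nat R) (le_lt_trans i1).
have ji : (j < i.+1)%N by rewrite -(ltr_nat R) (le_lt_trans j1).
by apply: val_inj; apply/eqP; rewrite eqn_leq -ltnS ij -ltnS ji.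
Qed.

End Adversary.

(** * Combining accuracy and privacy in a rarely hit bin *)

Lemma near_mean_accurate {R : realType} {d : measure_display}
    {Omega : measurableType d} (P : probability Omega R)
    (q : nat -> Omega -> seq bool -> R) (out : Omega -> seq bool -> R)
    (T : nat) (p eps delta x : R) :
  learner_measurable q out -> 1 / 2 < p < 1 ->
  accurate P q out T p eps delta -> 0 <= x <= 1 ->
  1 - delta <= mean P q T p x (near out eps x).
Proof.
move=> [mq [mout _]] p_itv acc x01.
have sN := statistic_near mout eps x.
have sc k : statistic (fun (_ : Omega) (_ : seq bool) => k : R).
  by move=> ys; exact: bounded_measurable_cst.
have sZ : statistic (fun w ys => (-1) * near out eps x w ys).
  by move=> ys; apply: bounded_measurableM (sc _ ys) (sN ys).
have sF : statistic (fun w ys => 1 + (-1) * near out eps x w ys).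
  by move=> ys; apply: bounded_measurableD (sc _ ys) (sZ ys).
have := acc x x01.
have -> : (fun (w : Omega) (ys : T.-tuple bool) =>
      if eps <= `|out w ys - x| then 1%E else 0%E : \bar R) =
    (fun w ys => (1 + (-1) * near out eps x w ys)%:E).
  (* The error event has [eps <=] and [near] has a strict inequality, so the two indicators add up
     to 1. *)
  apply/funext => w; apply/funext => ys; rewrite /near ltNge.
  by case: (eps <= _); rewrite /= ?mulr0 ?addr0 ?mulr1 ?subrr.
rewrite (trans_expect_mean P T p mq x sF) lee_fin meanD // mean_cst meanZ //; lra.
Qed.

(* The [M] candidate optimizers lie in the left half of the bin, so that
   [x, x + eps_adv[] stays inside it, and are [2 * eps] apart, so that an output
   is [eps]-close to at most one of them. *)
Lemma rarely_hit_bin_bound {R : realType} {d : measure_display}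
    {Omega : measurableType d} (P : probability Omega R)
    (q : nat -> Omega -> seq bool -> R) (out : Omega -> seq bool -> R)
    (T : nat) (p eps delta eps_adv delta_adv a b : R) :
  secure_algorithm P q out T p eps delta eps_adv delta_adv ->
  1 / 2 < p < 1 -> 0 <= delta <= 1 / 2 -> 0 < eps -> 2 * eps <= eps_adv ->
  0 <= a -> b <= 1 -> b - a < 1 -> 32 * eps_adv <= b - a ->
  unit_average (mean_share P q T p a b) <= b - a ->
  (1 - delta) * ln (eps_adv / eps) * (eps_adv / (b - a)) <=
  cp p * T%:R * delta_adv.
Proof.
move=> [ml [acc priv]] p_itv /andP[dl0 dl1] e0 ea2 a0 b1 l1 l32 nu_le.
have [mq [mout _]] := ml.
have cp0 := cp_gt0 p_itv.
have ea0 : 0 < eps_adv by lra.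
have l0 : 0 < b - a by lra.
pose s := (b - a) / (4 * eps).
have sE : s * eps = (b - a) / 4 by rewrite /s; field; lra.
have r2 : 2 <= eps_adv / eps by rewrite ler_pdivlMr.
have s8 : 8 * (eps_adv / eps) <= s.
  rewrite ler_pdivlMr; last lra.
  by have -> : 8 * (eps_adv / eps) * (4 * eps) = 32 * eps_adv by field; lra.
have s0 : 0 <= s by lra.
pose M := Num.truncn s.
have /andP[Mle Mlt] := truncn_itv s0; rewrite -/M -natr1 in Mle Mlt.
have M4 : 4 * (eps_adv / eps) <= M%:R by lra.
have M0 : (0 < M)%N by rewrite -(ltr_nat R); lra.
pose x (k : nat) := a + 2 * eps * k%:R.
have sep j k z : `|z - x j| < eps -> `|z - x k| < eps -> j = k.
  rewrite !ltr_distl => /andP[j1 j2] /andP[k1 k2].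
  have jk : (j < k.+1)%N.
    by rewrite -(ltr_nat R) -natr1 -(ltr_pM2l e0); rewrite /x in j1 j2 k1 k2; lra.
  have kj : (k < j.+1)%N.
    by rewrite -(ltr_nat R) -natr1 -(ltr_pM2l e0); rewrite /x in j1 j2 k1 k2; lra.
  by apply/eqP; rewrite eqn_leq -ltnS jk -ltnS kj.
(* The reference optimizer is the left endpoint [a]; the true one is the candidate rarely output
   under [a]. *)
have [k kM misk] := exists_rarely_output P T mq mout p_itv a M0 sep.
have ax : a <= x k by rewrite lerDl !mulr_ge0 //; lra.
have xl : x k <= a + (b - a) / 2.
  rewrite lerD2l; apply: (@le_trans _ _ (2 * eps * s)); last by lra.
  rewrite ler_pM2l; last lra.
  by apply: le_trans Mle; rewrite ler_nat ltnW.
have xb : x k + eps_adv <= b by lra.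
have x01 : 0 <= x k <= 1 by apply/andP; split; lra.
have xab : a <= x k < b by apply/andP; split; lra.
have aab : a <= a < b by apply/andP; split; lra.
have l01 : 0 < b - a < 1 by rewrite l0.
have M1 : 1 <= M%:R :> R by rewrite ler1n.
have accx := near_mean_accurate ml p_itv acc x01.
have lower := hits_lower_bound mq mout p_itv xab aab M1 accx misk.
rewrite mean_hit_count // in lower.
have upper := private_mean_share mq p_itv priv a0 b1 l01 ea0 nu_le ax xb.
set S := mean_share _ _ _ _ _ _ _ in lower upper.
have ln2 : 0 <= ln (2 : R) by rewrite ln_ge0; lra.
(* The factor 4 in [M4] yields [2 * ln 2], and [(1 - delta) * (2 * ln 2)] absorbs the loss [ln 2] of
   the change of measure as [delta <= 1 / 2]. *)
have lnM_ge : 2 * ln 2 + ln (eps_adv / eps) <= ln (M%:R : R).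
  have r0 : 0 < eps_adv / eps by exact: divr_gt0.
  have -> : 2 * ln 2 = ln (2 ^+ 2) :> R by rewrite lnXn // mulr_natl.
  have -> : 2 ^+ 2 = 4 :> R by ring.
  have MR0 : 0 < M%:R :> R by rewrite ltr0n.
  have r40 : 0 < 4 * (eps_adv / eps) by rewrite mulr_gt0.
  by rewrite -lnM ?posrE // ler_ln.
have d1 : 0 <= 1 - delta by lra.
have lnM_delta := ler_wpM2l d1 lnM_ge.
have ln2_delta : 0 <= (1 - 2 * delta) * ln 2 by rewrite mulr_ge0 //; lra.
have low : (1 - delta) * ln (eps_adv / eps) <= cp p * (T%:R * S) by lra.
have ea_l : 0 <= eps_adv / (b - a) by rewrite divr_ge0 // ltW.
apply: le_trans (ler_wpM2r ea_l low) _.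
have -> : cp p * (T%:R * S) * (eps_adv / (b - a)) =
    cp p * T%:R * (S * (eps_adv / (b - a))) by ring.
by apply: ler_wpM2l; rewrite // mulr_ge0 // ltW.
Qed.

Theorem theorem3 (R : realType) :
  exists C : R, 0 < C /\
  exists delta0 : R, 0 < delta0 /\
  forall delta delta_adv eps eps_adv p : R,
    0 < delta < delta0 -> 0 < delta_adv < delta0 -> 0 < eps ->
    2 * eps <= eps_adv -> eps_adv <= delta_adv / 2 ->
    1 / 2 < p < 1 ->
    forall (T : nat) (d : measure_display) (Omega : measurableType d)
           (P : probability Omega R)
           (q : nat -> Omega -> seq bool -> R) (out : Omega -> seq bool -> R),
      @secure_algorithm _ _ _ P q out T p eps delta eps_adv delta_adv ->
      C * ((1 - delta) / (delta_adv * cp p)) * ln (eps_adv / eps) <= T%:R.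
Proof.
(* This is the lower bound [l64] for [ea / (b - a)], the chance that a uniform draw from the bin
   falls in a given subinterval of length [ea]. *)
exists (1 / 64); split; first by lra.
(* With this bound [ea] is below [1 / 64], so there are at least two bins and the complement of a
   bin has positive length. *)
exists (1 / 32); split; first by lra.
move=> delta da eps ea p /andP[dl0 dl1] /andP[da0 da1] e0 ea2 eada p_itv.
move=> T d Omega P q out secure.
have [[mq _] _] := secure.
have cp0 := cp_gt0 p_itv.
have ea0 : 0 < ea by lra.
have k2 : 2 <= (32 * ea)^-1 by rewrite -[leLHS]invrK lef_pV2 ?posrE; lra.
have k0 : 0 <= (32 * ea)^-1 by lra.
pose m := Num.truncn (32 * ea)^-1.
have /andP[mle mlt] := truncn_itv k0; rewrite -/m in mle mlt.
have m2 : (1 < m)%N by rewrite -ltnS -(ltr_nat R); apply: le_lt_trans mlt.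
have mR : 2 <= m%:R :> R by rewrite ler_nat.
have [i nu_le] := exists_rarely_hit_bin P T mq p_itv (ltnW m2).
set a := i%:R / m%:R in nu_le; set b := i.+1%:R / m%:R in nu_le.
have ba : b - a = m%:R^-1 by rewrite /b /a -natr1 mulrDl mul1r addrAC subrr add0r.
rewrite -ba in nu_le.
have l32 : 32 * ea <= b - a.
  by rewrite ba -[leLHS]invrK lef_pV2 ?posrE //; lra.
(* Rounding down to [m] costs at most a factor 2, because [m + 1 <= 2 * m]; hence 64 in place of
   32. *)
have l64 : 1 / 64 <= ea / (b - a).
  have eV : 32 * ea * (32 * ea)^-1 = 1 by rewrite divff; lra.
  have h1 : 1 < 32 * ea * (m%:R + 1) by rewrite -[ltLHS]eV ltr_pM2l ?natr1 //; lra.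
  have h2 : 0 <= ea * (m%:R - 1) by rewrite mulr_ge0; lra.
  by rewrite ba invrK; lra.
have l1 : b - a < 1 by rewrite ba invf_lt1; lra.
have a0 : 0 <= a by rewrite divr_ge0.
have b1 : b <= 1 by rewrite ler_pdivrMr ?mul1r ?ler_nat //; lra.
have delta_itv : 0 <= delta <= 1 / 2 by apply/andP; split; lra.
have := rarely_hit_bin_bound secure p_itv delta_itv e0 ea2 a0 b1 l1 l32 nu_le.
have main0 : 0 <= (1 - delta) * ln (ea / eps).
  by rewrite mulr_ge0 ?ln_ge0 ?ler_pdivlMr //; lra.
move/(le_trans (ler_wpM2l main0 l64)) => main.
have -> : 1 / 64 * ((1 - delta) / (da * cp p)) * ln (ea / eps) =
    (1 - delta) * ln (ea / eps) * (1 / 64) / (da * cp p).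
  by field; rewrite !gt_eqF.
have dcp0 : 0 < da * cp p by exact: mulr_gt0.
rewrite ler_pdivrMr //.
by have -> : T%:R * (da * cp p) = cp p * T%:R * da by ring.
Qed.
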